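(* Let $\omega=\sqrt{-7}$ (so $\omega^2=-7$), and let $\mathbb{Z}[\omega][x,y,z]=\mathbb{Z}[\omega][X,Y,Z]/(X^2+Y^2+Z^2-1)$, where $x,y,z$ denote the images of the polynomial variables $X,Y,Z$. Consider the matrix with entries in $\mathbb{Z}[\omega][x,y,z]$ \[ M=\begin{pmatrix} x & y & z \\ \omega y - 5 z & 2\omega x - \omega y + 8 z + 3 & -5 x + 5 y + 4\omega z + \omega \\ -6 z + 1 & 3\omega x + \omega y + 9 z + 1 & -7 x + y + 5\omega z \end{pmatrix}. \] Then $\det(M)=5$ in $\mathbb{Z}[\omega][x,y,z]$. *)

(* Defs.v *)
From HB Require Import structures.
From mathcomp Require Import all_boot all_order all_algebra all_field.
From mathcomp Require Import boolp.
From mathcomp Require Import mpoly.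

Set Implicit Arguments.
Unset Strict Implicit.
Unset Printing Implicit Defensive.

Import Order.TTheory GRing.Theory Num.Theory.
Local Open Scope ring_scope.

Definition sqrtm7 : algC := sqrtC (- 7%:R).

Lemma sqrtm7_sq : sqrtm7 ^+ 2 = - 7%:R.
Proof. exact: sqrtCK. Qed.

(* Z[sqrt -7] as the subring of algC of all values p(sqrt -7), p in Z[T];
   this is not the full ring of integers of Q(sqrt -7). *)
Definition Zomega_pred : {pred algC} :=
  fun u => `[< exists p : {poly int}, u = (map_poly intr p).[sqrtm7] >].

Lemma Zomega_subring : subring_closed Zomega_pred.
Proof.
split.
- by apply/asboolP; exists 1; rewrite rmorph1 hornerC.
- move=> u v /asboolP[p ->] /asboolP[q ->]; apply/asboolP; exists (p - q).
  by rewrite rmorphB hornerD hornerN.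
- move=> u v /asboolP[p ->] /asboolP[q ->]; apply/asboolP; exists (p * q).
  by rewrite rmorphM hornerM.
Qed.

HB.instance Definition _ :=
  GRing.isSubringClosed.Build algC Zomega_pred Zomega_subring.

Record Zomega := MkZomega {
  Zomega_val :> algC;
  Zomega_valP : Zomega_val \in Zomega_pred }.

HB.instance Definition _ := [isSub for Zomega_val].
HB.instance Definition _ := [Choice of Zomega by <:].
HB.instance Definition _ := [SubChoice_isSubComNzRing of Zomega by <:].

Lemma sqrtm7_Zomega : sqrtm7 \in Zomega_pred.
Proof. by apply/asboolP; exists 'X; rewrite map_polyX hornerX. Qed.

Definition omega : Zomega := MkZomega sqrtm7_Zomega.

Lemma omega_sq : omega ^+ 2 = - 7%:R.
Proof.
by apply: val_inj; rewrite rmorphXn rmorphN rmorph_nat; exact: sqrtm7_sq.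
Qed.

Notation ZomegaXYZ := {mpoly Zomega[3]}.

Definition polX : ZomegaXYZ := 'X_(inord 0).
Definition polY : ZomegaXYZ := 'X_(inord 1).
Definition polZ : ZomegaXYZ := 'X_(inord 2).

Definition sphere_poly : ZomegaXYZ := polX ^+ 2 + polY ^+ 2 + polZ ^+ 2 - 1.

Definition sphere_ideal : {pred ZomegaXYZ} :=
  fun f => `[< exists g : ZomegaXYZ, f = g * sphere_poly >].

Lemma sphere_ideal_closed : idealr_closed sphere_ideal.
Proof.
split.
- by apply/asboolP; exists 0; rewrite mul0r.
- apply/negP => /asboolP[g /(congr1 (meval (fun i => (val i == 0%N)%:R)))].
  rewrite rmorph1 rmorphM rmorphB !rmorphD !rmorphXn rmorph1 /=.
  rewrite !mevalXU /= !inordK //= expr1n !expr0n /= !addr0 subrr mulr0.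
  by move/eqP; rewrite oner_eq0.
- move=> a u v /asboolP[g ->] /asboolP[h ->].
  by apply/asboolP; exists (a * g + h); rewrite mulrDl mulrA.
Qed.

HB.instance Definition _ :=
  isIdealr.Build ZomegaXYZ sphere_ideal sphere_ideal_closed.

(* Z[omega][x, y, z] = Z[omega][X, Y, Z] / (X^2 + Y^2 + Z^2 - 1) *)
Definition sphere_ring := {ideal_quot sphere_ideal}.

HB.instance Definition _ := GRing.ComNzRing.on sphere_ring.

Definition sphere_proj (f : ZomegaXYZ) : sphere_ring :=
  (\pi_({ideal_quot sphere_ideal}) f)%qT.

Definition x : sphere_ring := sphere_proj polX.
Definition y : sphere_ring := sphere_proj polY.
Definition z : sphere_ring := sphere_proj polZ.

Definition w : sphere_ring := sphere_proj omega%:MP.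

(* Row-major listing; the defaults of nth are never reached. *)
Definition mx3 (R : Type) (a b c d e f g h i : R) : 'M[R]_3 :=
  \matrix_(r < 3, s < 3)
    nth a (nth [::] [:: [:: a; b; c]; [:: d; e; f]; [:: g; h; i]] r) s.

Definition M : 'M[sphere_ring]_3 :=
  mx3
    x y z
    (w * y - 5%:R * z)
    (2%:R * w * x - w * y + 8%:R * z + 3%:R)
    (- 5%:R * x + 5%:R * y + 4%:R * w * z + w)
    (- 6%:R * z + 1)
    (3%:R * w * x + w * y + 9%:R * z + 1)
    (- 7%:R * x + y + 5%:R * w * z).

(* Main.v *)
(** The determinant of [M], expanded as a polynomial in [x], [y], [z], [w],
    differs from [5] by a combination of [w^2 + 7] and [x^2 + y^2 + z^2 - 1]. *)
Require Import Defs.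
From mathcomp Require Import all_boot all_order all_algebra.
From mathcomp Require Import mpoly ring.

Import GRing.Theory.
Local Open Scope ring_scope.

(** The computation is an identity over any commutative ring with [x], [y], [z], [w] free
    ([det_M_cofactors]). In [sphere_ring] both correction terms vanish, by [w_sq] and [sphere_eq],
    leaving 5. *)

Lemma det_mx3 (R : comNzRingType) (a b c d e f g h i : R) :
  \det (mx3 a b c d e f g h i) =
  a * (e * i - f * h) - b * (d * i - f * g) + c * (d * h - e * g).
Proof.
rewrite (expand_det_row _ ord0) !big_ord_recl big_ord0 /cofactor.
rewrite !(expand_det_row _ ord0) !big_ord_recl !big_ord0 /cofactor !det_mx11.
rewrite !mxE /=; ring.
Qed.

(* The quotients come from dividing the expanded left-hand side minus [5],
   first by [w^2 + 7] and then by [x^2 + y^2 + z^2 - 1]. *)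
Lemma det_M_cofactors (R : comNzRingType) (x y z w : R) :
  \det (mx3 x y z
          (w * y - 5%:R * z)
          (2%:R * w * x - w * y + 8%:R * z + 3%:R)
          (- 5%:R * x + 5%:R * y + 4%:R * w * z + w)
          (- 6%:R * z + 1)
          (3%:R * w * x + w * y + 9%:R * z + 1)
          (- 7%:R * x + y + 5%:R * w * z)) =
  5%:R
  - (2%:R * x ^+ 2 * z + 3%:R * x ^+ 2 + 6%:R * x * y * z + x * y
     + 4%:R * y ^+ 2 * z) * (w ^+ 2 + 7%:R)
  + (w * x - w * y + 3%:R * z + 5%:R) * (x ^+ 2 + y ^+ 2 + z ^+ 2 - 1).
Proof. by rewrite det_mx3; ring. Qed.

(** Inherited from [omega_sq] through the ring morphisms [mpolyC] and [sphere_proj]. *)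
Lemma w_sq : w ^+ 2 + 7%:R = 0.
Proof.
have -> : w ^+ 2 + 7%:R = sphere_proj (omega%:MP ^+ 2 + 7%:R).
  by rewrite /sphere_proj rmorphD rmorphXn rmorph_nat.
by rewrite -rmorphXn /= omega_sq rmorphN /= rmorph_nat addNr /sphere_proj rmorph0.
Qed.

Lemma sphere_eq : x ^+ 2 + y ^+ 2 + z ^+ 2 - 1 = 0.
Proof.
have -> : x ^+ 2 + y ^+ 2 + z ^+ 2 - 1 = sphere_proj sphere_poly.
  by rewrite /sphere_proj rmorphB !rmorphD !rmorphXn rmorph1.
rewrite /sphere_proj -(rmorph0 (\pi_({ideal_quot sphere_ideal})%qT)).
(* Vanishing in the quotient is membership in the ideal, which [sphere_poly] generates: cofactor
   1. *)
apply/eqP; rewrite -Quotient.idealrBE subr0.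
by apply/boolp.asboolP; exists 1; rewrite mul1r.
Qed.

Theorem theorem1p3 : ((\det M)%R = 5%:R%R :> sphere_ring).
Proof. by rewrite /M det_M_cofactors w_sq sphere_eq !mulr0 subr0 addr0. Qed.
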